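(* Let $(A,\circ,P)$ be a Rota-Baxter pre-Lie algebra of weight $\lambda$, with sub-adjacent Rota-Baxter Lie algebra $(\mathfrak{g}(A),[-,-],P)$, $[x,y]=x\circ y-y\circ x$. Let $\{e_1,\cdots,e_n\}$ be a basis of $A$, $\{e_1^*,\cdots,e_n^*\}$ be the dual basis and $r=\sum_{i=1}^{n}(e_{i}\otimes e^{*}_{i}-e^{*}_{i}\otimes e_{i})$. Define the linear map $\delta=\delta_{r}$ on $\mathfrak{g}(A)\ltimes_{\mathcal{L}^{*}_{\circ}}A^{*}$ by $\delta_r(u)=(\mathrm{ad}(u)\otimes\mathrm{id}+\mathrm{id}\otimes\mathrm{ad}(u))r$. Then there are Rota-Baxter Lie bialgebras (of weight $\lambda$) $$(\mathfrak{g}(A)\ltimes_{\mathcal{L}^{*}_{\circ}}A^{*},\,P,\,\delta,\,P^{*}),\qquad (\mathfrak{g}(A)\ltimes_{\mathcal{L}^{*}_{\circ}}A^{*},\,P-\lambda\mathrm{id}_{A^{*}},\,\delta,\,-\lambda\mathrm{id}_{A}+P^{*}),$$ $$(\mathfrak{g}(A)\ltimes_{\mathcal{L}^{*}_{\circ}}A^{*},\,P-\lambda\mathrm{id}_{A^{*}}-P^{*},\,\delta,\,-P-\lambda\mathrm{id}_{A}+P^{*}).$$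
   Context: All vector spaces and algebras are finite-dimensional over a field $\mathbb K$ of characteristic zero; $\lambda\in\mathbb K$. A pre-Lie algebra is $(A,\circ)$ with $(x\circ y)\circ z-x\circ(y\circ z)=(y\circ x)\circ z-y\circ(x\circ z)$. A Rota-Baxter pre-Lie algebra of weight $\lambda$ is $(A,\circ,P)$ with $P:A\to A$ linear and $P(x)\circ P(y)=P(P(x)\circ y)+P(x\circ P(y))+\lambda P(x\circ y)$; then $P$ is also a Rota-Baxter operator of weight $\lambda$ on the Lie algebra $\mathfrak g(A)=(A,[-,-])$. $\mathcal L_\circ(x)y=x\circ y$; $\mathcal L_\circ^*:A\to\mathrm{End}(A^* )$ is given by $\langle\mathcal L_\circ^*(x)a^*,y\rangle=-\langle a^*,x\circ y\rangle$. $\mathfrak g(A)\ltimes_{\mathcal L_\circ^*}A^*$ is the Lie algebra $A\oplus A^*$ with $[x+a^*,y+b^*]=[x,y]+\mathcal L_\circ^*(x)b^*-\mathcal L_\circ^*(y)a^*$; $\mathrm{ad}(u)v=[u,v]$. $P^*:A^*\to A^*$ is the transpose of $P$. An operator on $A\oplus A^*$ written as a sum of operators on $A$ and on $A^*$ acts on each summand by the corresponding operators, and by zero on a summand for which no operator is written (e.g. $P$ means $x+a^*\mapsto P(x)$, $P^*$ means $x+a^*\mapsto P^*(a^* )$, $P-\lambda\mathrm{id}_{A^*}-P^*$ means $x+a^*\mapsto P(x)-\lambda a^*-P^*(a^* )$). A Rota-Baxter Lie bialgebra $(\mathfrak h,R,\delta,S)$ of weight $\lambda$ consists of a Lie bialgebra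 $(\mathfrak h,[-,-],\delta)$ and linear maps $R,S:\mathfrak h\to\mathfrak h$ such that for all $x,y\in\mathfrak h$: $[R(x),R(y)]=R([x,R(y)])+R([R(x),y])+\lambda R([x,y])$; $(S\otimes S)\delta(x)=(S\otimes\mathrm{id}+\mathrm{id}\otimes S)\delta(S(x))+\lambda\delta(S(x))$; $S([R(x),y])-[R(x),S(y)]-S([x,S(y)])-\lambda[x,S(y)]=0$; $(R\otimes S)\delta(x)+(R\otimes\mathrm{id}-\mathrm{id}\otimes S)\delta(R(x))+\lambda(R\otimes\mathrm{id})\delta(x)=0$. (A Lie bialgebra is a Lie algebra with a Lie coalgebra structure $\delta$ satisfying $\delta([x,y])=(\mathrm{ad}(x)\otimes \mathrm{id}+\mathrm{id}\otimes\mathrm{ad}(x))\delta(y)-(\mathrm{ad}(y)\otimes \mathrm{id}+\mathrm{id}\otimes\mathrm{ad}(y))\delta(x)$.) *)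

(* Defs.v *)
From HB Require Import structures.
From mathcomp Require Import all_boot all_order all_algebra.

Set Implicit Arguments.
Unset Strict Implicit.
Unset Printing Implicit Defensive.

Import GRing.Theory.
Local Open Scope ring_scope.

(* Operations are plain functions and their (bi)linearity is a field of the
   predicates below.  The dual of V is 'Hom(V, K^o).  [linfun f] agrees with f
   only when f is linear; here it is only ever applied to functions that are
   linear, possibly by virtue of those predicates. *)

Definition bilinear_op (K : fieldType) (U V W : vectType K)
    (f : U -> V -> W) : Prop :=
  (forall v, linear (f^~ v)) /\ (forall u, linear (f u)).

(* For finite-dimensional spaces V (x) W is Hom(V^*, W), the pure tensor
   v (x) w being phi |-> phi(v) w.  The lemmas tens_bilinear, tens_lift_linear,
   tens_lift_tens and tens_lift_unique are the universal property. *)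
Definition tensor (K : fieldType) (V W : vectType K) : vectType K :=
  'Hom('Hom(V, K^o), W).

Definition tens (K : fieldType) (V W : vectType K) (v : V) (w : W) :
    tensor V W :=
  linfun (fun phi : 'Hom(V, K^o) => (phi v : K) *: w).

Definition dual_basis (K : fieldType) (V : vectType K) (n : nat)
    (e : n.-tuple V) (i : 'I_n) : 'Hom(V, K^o) :=
  linfun (coord e i : V -> K^o).

Definition tens_lift (K : fieldType) (V W U : vectType K) (f : V -> W -> U)
    (t : tensor V W) : U :=
  \sum_(i < \dim {:V}) f (vbasis {:V})`_i ((t : 'Hom(_, _)) (dual_basis (vbasis {:V}) i)).

Section TensorUniversalProperty.
Context (K : fieldType) (V W U : vectType K).

Lemma tensE (v : V) (w : W) (phi : 'Hom(V, K^o)) :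
  (tens v w : 'Hom(_, _)) phi = (phi v : K) *: w.
Proof.
have lin : linear (fun psi : 'Hom(V, K^o) => (psi v : K) *: w).
  by move=> a p q; rewrite add_lfunE scale_lfunE scalerDl -scalerA.
pose F := GRing.isLinear.Build _ _ _ _ _ lin.
pose G : {linear _ -> _} := HB.pack (fun psi : 'Hom(V, K^o) => (psi v : K) *: w) F.
exact: (lfunE G phi).
Qed.

Lemma dual_basisE n (e : n.-tuple V) i v : dual_basis e i v = coord e i v.
Proof. by rewrite /dual_basis lfunE. Qed.

Lemma tens_bilinear : bilinear_op (@tens K V W).
Proof.
split=> [w a x y | v a x y]; apply/lfunP => phi; rewrite add_lfunE scale_lfunE !tensE.
  by rewrite linearP scalerDl -scalerA.
by rewrite scalerDr !scalerA mulrC.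
Qed.

Lemma tens_sum (t : tensor V W) :
  t = \sum_(i < \dim {:V}) tens (vbasis {:V})`_i
                  ((t : 'Hom(_, _)) (dual_basis (vbasis {:V}) i)).
Proof.
apply/lfunP => phi; rewrite sum_lfunE.
have {1}-> : phi = \sum_(i < \dim {:V}) (phi (vbasis {:V})`_i : K) *: dual_basis (vbasis {:V}) i.
  apply/lfunP => v; rewrite sum_lfunE {1}(coord_vbasis (memvf v)) linear_sum.
  by apply: eq_bigr => i _; rewrite linearZ scale_lfunE dual_basisE; exact: mulrC.
by rewrite linear_sum; apply: eq_bigr => i _; rewrite tensE linearZ.
Qed.

Lemma tens_lift_linear (f : V -> W -> U) :
  bilinear_op f -> linear (tens_lift f).
Proof.
case=> _ fr a s t; rewrite /tens_lift scaler_sumr -big_split /=.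
by apply: eq_bigr => i _; rewrite add_lfunE scale_lfunE fr.
Qed.

Lemma tens_lift_tens (f : V -> W -> U) v w :
  bilinear_op f -> tens_lift f (tens v w) = f v w.
Proof.
case=> fl fr.
pose G : {linear _ -> _} :=
  HB.pack (f^~ w) (GRing.isLinear.Build _ _ _ _ _ (fl w)).
rewrite -[RHS]/(G v) {2}(coord_vbasis (memvf v)) linear_sum.
apply: eq_bigr => i _; rewrite tensE dual_basisE linearZ /=.
pose H : {linear _ -> _} :=
  HB.pack (f (vbasis {:V})`_i) (GRing.isLinear.Build _ _ _ _ _ (fr _)).
by rewrite -[f _]/(H : _ -> _) linearZ.
Qed.

Lemma tens_lift_unique (f : V -> W -> U) (h : tensor V W -> U) :
  linear h -> (forall v w, h (tens v w) = f v w) -> h =1 tens_lift f.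
Proof.
move=> hl hf t; rewrite {1}(tens_sum t).
pose H : {linear _ -> _} := HB.pack h (GRing.isLinear.Build _ _ _ _ _ hl).
by rewrite -[h]/(H : _ -> _) linear_sum; apply: eq_bigr => i _; exact: hf.
Qed.

End TensorUniversalProperty.

Definition tens_map (K : fieldType) (V V' W W' : vectType K)
    (f : V -> V') (g : W -> W') : tensor V W -> tensor V' W' :=
  tens_lift (fun v w => tens (f v) (g w)).

Definition tens_flip (K : fieldType) (V W : vectType K) :
    tensor V W -> tensor W V :=
  tens_lift (fun v w => tens w v).

(* x (x) (y (x) z) |-> y (x) (z (x) x) *)
Definition tens_cycle (K : fieldType) (V : vectType K) :
    tensor V (tensor V V) -> tensor V (tensor V V) :=
  tens_lift (fun x => tens_lift (fun y z => tens y (tens z x))).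

Definition rota_baxter_op (K : fieldType) (A : vectType K) (lambda : K)
    (mul : A -> A -> A) (P : A -> A) : Prop :=
  forall x y, mul (P x) (P y)
    = P (mul (P x) y) + P (mul x (P y)) + lambda *: P (mul x y).

Record pre_lie_algebra (K : fieldType) (A : vectType K)
    (circ : A -> A -> A) : Prop := {
  pre_lie_bilinear : bilinear_op circ;
  pre_lie_left_sym : forall x y z,
    circ (circ x y) z - circ x (circ y z)
    = circ (circ y x) z - circ y (circ x z) }.

Record rota_baxter_pre_lie_algebra (K : fieldType) (A : vectType K)
    (lambda : K) (circ : A -> A -> A) (P : A -> A) : Prop := {
  rbpl_pre_lie : pre_lie_algebra circ;
  rbpl_linear : linear P;
  rbpl_rota_baxter : rota_baxter_op lambda circ P }.

Record lie_algebra (K : fieldType) (h : vectType K)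
    (br : h -> h -> h) : Prop := {
  lie_bilinear : bilinear_op br;
  lie_alternating : forall x, br x x = 0;
  lie_jacobi : forall x y z,
    br x (br y z) + br y (br z x) + br z (br x y) = 0 }.

Record lie_coalgebra (K : fieldType) (h : vectType K)
    (delta : h -> tensor h h) : Prop := {
  lie_co_linear : linear delta;
  lie_co_antisym : forall x, delta x = - tens_flip (delta x);
  lie_co_jacobi : forall x,
    let t := tens_map id delta (delta x) in
    t + tens_cycle t + tens_cycle (tens_cycle t) = 0 }.

(* (ad(u) (x) id + id (x) ad(u)) t *)
Definition ad_tens (K : fieldType) (h : vectType K) (br : h -> h -> h)
    (u : h) (t : tensor h h) : tensor h h :=
  tens_map (br u) id t + tens_map id (br u) t.

Record lie_bialgebra (K : fieldType) (h : vectType K)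
    (br : h -> h -> h) (delta : h -> tensor h h) : Prop := {
  lie_bi_algebra : lie_algebra br;
  lie_bi_coalgebra : lie_coalgebra delta;
  lie_bi_cocycle : forall x y,
    delta (br x y) = ad_tens br x (delta y) - ad_tens br y (delta x) }.

Record rota_baxter_lie_bialgebra (K : fieldType) (h : vectType K) (lambda : K)
    (br : h -> h -> h) (R : h -> h) (delta : h -> tensor h h) (S : h -> h) :
    Prop := {
  rblb_lie_bialgebra : lie_bialgebra br delta;
  rblb_R_linear : linear R;
  rblb_S_linear : linear S;
  rblb_R : rota_baxter_op lambda br R;
  rblb_S : forall x,
    tens_map S S (delta x)
    = tens_map S id (delta (S x)) + tens_map id S (delta (S x))
      + lambda *: delta (S x);
  rblb_bracket : forall x y,
    S (br (R x) y) - br (R x) (S y) - S (br x (S y)) - lambda *: br x (S y)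
    = 0;
  rblb_cobracket : forall x,
    tens_map R S (delta x)
    + (tens_map R id (delta (R x)) - tens_map id S (delta (R x)))
    + lambda *: tens_map R id (delta x) = 0 }.

Definition commutator (K : fieldType) (A : vectType K) (circ : A -> A -> A)
    (x y : A) : A := circ x y - circ y x.

Definition transpose (K : fieldType) (A : vectType K) (P : A -> A)
    (phi : 'Hom(A, K^o)) : 'Hom(A, K^o) :=
  linfun (fun y => phi (P y)).

Definition L_star (K : fieldType) (A : vectType K) (circ : A -> A -> A)
    (x : A) (phi : 'Hom(A, K^o)) : 'Hom(A, K^o) :=
  linfun (fun y => - phi (circ x y)).

Definition semidirect (K : fieldType) (g V : vectType K) (br : g -> g -> g)
    (rho : g -> V -> V) (u v : (g * V)%type) : (g * V)%type :=
  (br u.1 v.1, rho u.1 v.2 - rho v.1 u.2).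

(* [x + a, y + b] = [x, y] + L^*(x) b - L^*(y) a *)
Definition dual_semidirect (K : fieldType) (A : vectType K)
    (circ : A -> A -> A) :=
  semidirect (commutator circ) (L_star circ).

Definition canonical_r (K : fieldType) (A : vectType K) (n : nat)
    (e : n.-tuple A) :
    tensor (A * 'Hom(A, K^o))%type (A * 'Hom(A, K^o))%type :=
  \sum_(i < n) (tens (e`_i, 0) (0, dual_basis e i)
          - tens (0, dual_basis e i) (e`_i, 0)).

(* Main.v *)
(* The pairing omega (x + a, y + b) = a(y) - b(x), for x, y in A and a, b in the
   dual A', is a symplectic form on the Lie algebra h = g(A) + A', and r is the
   inverse of the induced map h -> h'.  Identifying h' with h through omega, the
   cobracket delta_r is dual to the bracket of h, so the co-Jacobi identity is
   the Jacobi identity.  For R with omega-adjoint S, the condition on S and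
   delta becomes the Rota-Baxter identity of R, and the condition linking R, S
   and delta becomes the one linking R, S and the bracket.  In the three cases
   R is P on A and the transpose of Q on A', with Q = 0, Q = - lambda id and
   Q = - lambda id - P respectively, and S is the adjoint of R. *)

Require Import Defs.
From HB Require Import structures.
From mathcomp Require Import all_boot all_order all_algebra.
From mathcomp Require Import ring.
Local Open Scope ring_scope.

Set Implicit Arguments.
Unset Strict Implicit.
Unset Printing Implicit Defensive.
Import GRing.Theory.

(** * Evaluation of linear functionals *)

Section Evaluation.
Context (K : fieldType) (V : vectType K).
Implicit Types (phi psi : 'Hom(V, K^o)) (x y : V) (a : K).

Lemma dual_addr phi x y : phi (x + y) = (phi x : K) + phi y.
Proof. exact: linearD. Qed.
Lemma dual_oppr phi x : phi (- x) = - (phi x : K).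
Proof. exact: linearN. Qed.
Lemma dual_scaler phi a x : phi (a *: x) = a * (phi x : K).
Proof. exact: linearZ. Qed.
Lemma dual_zeror phi : phi 0 = 0 :> K.
Proof. exact: (linear0 phi). Qed.
Lemma dual_addl phi psi x : (phi + psi) x = (phi x : K) + psi x.
Proof. exact: add_lfunE. Qed.
Lemma dual_oppl phi x : (- phi) x = - (phi x : K).
Proof. exact: opp_lfunE. Qed.
Lemma dual_scalel a phi x : (a *: phi) x = a * (phi x : K).
Proof. exact: scale_lfunE. Qed.
Lemma dual_zerol x : (0 : 'Hom(V, K^o)) x = 0 :> K.
Proof. by rewrite zero_lfunE. Qed.

(** Values are read in [K], with [*] for scaling, so that [ring] applies after rewriting with this
    family. *)
Definition dualE := (dual_addr, dual_oppr, dual_scaler, dual_zeror,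
                     dual_addl, dual_oppl, dual_scalel, dual_zerol).

Lemma dual_eq phi psi : (forall x, phi x = psi x :> K) -> phi = psi.
Proof. by move=> e; apply/lfunP. Qed.

End Evaluation.

(** * Linear maps given as plain functions *)

Section LinearMaps.
Context (K : fieldType) (U V : vectType K) (f : U -> V).
Hypothesis lf : linear f.

Let F : {linear U -> V} := HB.pack f (GRing.isLinear.Build _ _ _ _ _ lf).

Lemma linfun_linearE x : linfun f x = f x.
Proof. exact: (lfunE F x). Qed.

Lemma linear_fun0 : f 0 = 0. Proof. exact: (linear0 F). Qed.
Lemma linear_funD x y : f (x + y) = f x + f y. Proof. exact: (linearD F). Qed.
Lemma linear_funN x : f (- x) = - f x. Proof. exact: (linearN F). Qed.
Lemma linear_funB x y : f (x - y) = f x - f y. Proof. exact: (linearB F). Qed.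
Lemma linear_funZ a x : f (a *: x) = a *: f x. Proof. exact: (linearZZ F). Qed.
Lemma linear_fun_sum I (s : seq I) (Q : pred I) (E : I -> U) :
  f (\sum_(i <- s | Q i) E i) = \sum_(i <- s | Q i) f (E i).
Proof. exact: (linear_sum F). Qed.

End LinearMaps.

Lemma transposeE (K : fieldType) (A : vectType K) (f : A -> A) :
  linear f -> forall phi x, transpose f phi x = phi (f x) :> K.
Proof.
by move=> lf phi x; rewrite /transpose linfun_linearE // => a u v; rewrite lf linearP.
Qed.

(** Coordinates in a basis are functionals; this reduces vector identities to scalar ones, within
    reach of [ring]. *)
Lemma dual_separates (K : fieldType) (V : vectType K) (x y : V) :
  (forall phi : 'Hom(V, K^o), phi x = phi y :> K) -> x = y.
Proof.
move=> h; rewrite (coord_vbasis (memvf x)) (coord_vbasis (memvf y)).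
by apply: eq_bigr => i _; rewrite -!dual_basisE h.
Qed.

(** * Tensors as multilinear forms on the dual *)

Section Tensors.
Context (K : fieldType).

Lemma tensor_eq (V W : vectType K) (s t : tensor V W) :
  (forall (phi : 'Hom(V, K^o)) (psi : 'Hom(W, K^o)),
     psi ((s : 'Hom(_, _)) phi) = psi ((t : 'Hom(_, _)) phi)) -> s = t.
Proof.
move=> h; apply/lfunP => phi; apply: dual_separates => psi; exact: h.
Qed.

Lemma tensor_ind (V W : vectType K) (Q : tensor V W -> Prop) :
  (forall s t, Q s -> Q t -> Q (s + t)) -> Q 0 ->
  (forall v w, Q (tens v w)) -> forall t, Q t.
Proof.
by move=> QD Q0 Qt t; rewrite (tens_sum t); apply: big_ind => // i _; exact: Qt.
Qed.

Lemma tens_map_bilinear (V V' W W' : vectType K) (f : V -> V') (g : W -> W') :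
  linear f -> linear g -> bilinear_op (fun v w => tens (f v) (g w)).
Proof.
move=> lf lg; have [bl br] := @tens_bilinear K V' W'.
by split=> [w | v] a x y; rewrite ?lf ?lg ?bl ?br.
Qed.

(** With tensors as maps out of the dual, f (x) g acts by composing with g on the left and with the
    transpose of f on the right. *)
Lemma tens_mapE (V W W' : vectType K) (f : V -> V) (g : W -> W')
    (t : tensor V W) phi :
  linear f -> linear g ->
  (tens_map f g t : 'Hom(_, _)) phi = g ((t : 'Hom(_, _)) (transpose f phi)).
Proof.
move=> lf lg; have bfg := tens_map_bilinear lf lg.
have lm := tens_lift_linear bfg.
elim/tensor_ind: t => [s t hs ht||v w].
- by rewrite /tens_map (linear_funD lm) !add_lfunE linear_funD // hs ht.
- by rewrite /tens_map (linear_fun0 lm) !zero_lfunE linear_fun0.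
by rewrite /tens_map tens_lift_tens // !tensE linear_funZ // transposeE.
Qed.

Lemma transpose_id (V : vectType K) (phi : 'Hom(V, K^o)) :
  transpose id phi = phi.
Proof. by apply/lfunP => x; rewrite transposeE. Qed.

Lemma tens_flipE (V W : vectType K) (t : tensor V W)
    (phi : 'Hom(W, K^o)) (psi : 'Hom(V, K^o)) :
  psi ((tens_flip t : 'Hom(_, _)) phi) = phi ((t : 'Hom(_, _)) psi) :> K.
Proof.
have bf : bilinear_op (fun (v : V) (w : W) => tens w v).
  by have [bl br] := @tens_bilinear K W V; split=> [w | v] a x y; rewrite ?bl ?br.
have lm := tens_lift_linear bf.
elim/tensor_ind: t => [s t hs ht||v w].
- by rewrite /tens_flip (linear_funD lm) !add_lfunE !linearD /= hs ht.
- by rewrite /tens_flip (linear_fun0 lm) !zero_lfunE !linear0.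
by rewrite /tens_flip tens_lift_tens // !tensE !linearZ /= [RHS]mulrC.
Qed.

(** This turns the co-Jacobi sum into a sum over cyclic permutations of three functionals. *)
Lemma tens_cycleE (V : vectType K) (t : tensor V (tensor V V))
    (phi psi chi : 'Hom(V, K^o)) :
  chi (((tens_cycle t : 'Hom(_, tensor V V)) phi : 'Hom(_, _)) psi)
  = psi (((t : 'Hom(_, tensor V V)) chi : 'Hom(_, _)) phi) :> K.
Proof.
have [tl tr] := @tens_bilinear K V V.
have [ul ur] := @tens_bilinear K V (tensor V V).
have b1 (x : V) : bilinear_op (fun y z : V => tens y (tens z x)).
  by split=> [w | v] a p q; rewrite ?ul ?tl ?ur.
have b2 : bilinear_op (fun x : V => tens_lift (fun y z : V => tens y (tens z x))).
  split=> [w | v]; last exact: tens_lift_linear.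
  elim/tensor_ind: w => [s t' hs ht a x y||v w a x y].
  - rewrite !(linear_funD (tens_lift_linear (b1 _))) hs ht scalerDr.
    by rewrite -!addrA; congr (_ + _); rewrite addrCA.
  - by move=> a x y; rewrite !(linear_fun0 (tens_lift_linear (b1 _))) scaler0 addr0.
  by rewrite !tens_lift_tens // tr ur.
have lm := tens_lift_linear b2.
elim/tensor_ind: t => [s t hs ht||v w].
- by rewrite /tens_cycle (linear_funD lm) !add_lfunE !linearD /= hs ht.
- by rewrite /tens_cycle (linear_fun0 lm) !zero_lfunE !linear0.
rewrite /tens_cycle tens_lift_tens //.
have l1 := tens_lift_linear (b1 v).
elim/tensor_ind: w => [s t hs ht||w z].
- by rewrite (linear_funD l1) (linear_funD (ur v)) !add_lfunE !linearD /= hs ht.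
- by rewrite (linear_fun0 l1) (linear_fun0 (ur v)) !zero_lfunE !linear0.
rewrite tens_lift_tens // !tensE !scale_lfunE !tensE !dualE; ring.
Qed.

End Tensors.

(** * The coboundary Lie bialgebra of a symplectic Lie algebra *)

Section SymplecticLieAlgebra.
Context (K : fieldType) (h : vectType K) (br : h -> h -> h).
Context (r : tensor h h) (omega : h -> h -> K).
Hypothesis lie_br : lie_algebra br.
Hypothesis omega_linear : forall w, linear (omega w : h -> K^o).
Hypothesis omega_antisym : forall u v, omega u v = - omega v u.
Hypothesis omega_r : forall (phi : 'Hom(h, K^o)) u,
  omega ((r : 'Hom(_, _)) phi) u = phi u.
Hypothesis omega_cocycle : forall u v w,
  omega (br u v) w + omega (br v w) u + omega (br w u) v = 0.

Local Notation sharp := (r : 'Hom('Hom(h, K^o), h)).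
Local Notation flat w := (linfun (omega w : h -> K^o)).
Local Notation delta := (fun u => ad_tens br u r).

Lemma linear_brl v : linear (br^~ v).
Proof. by case: lie_br => [[]]. Qed.

Lemma linear_brr u : linear (br u).
Proof. by case: lie_br => [[]]. Qed.

Lemma br_antisym u v : br u v = - br v u.
Proof.
have := lie_alternating lie_br (u + v).
rewrite (linear_funD (linear_brl _)) !(linear_funD (linear_brr _)).
rewrite !(lie_alternating lie_br) add0r addr0 => /eqP.
by rewrite addr_eq0 => /eqP.
Qed.

Lemma br_br x y z : br (br x y) z = br x (br y z) - br y (br x z).
Proof.
have /eqP := lie_jacobi lie_br x y z.
rewrite (br_antisym z (br x y)) subr_eq0 => /eqP <-.
by rewrite (br_antisym x z) (linear_funN (linear_brr _)) opprK.
Qed.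

(** By [omega_r] every functional is a pairing with some vector, and functionals separate points. *)
Lemma omega_inj u v : (forall w, omega w u = omega w v) -> u = v.
Proof. by move=> e; apply: dual_separates => phi; rewrite -!omega_r. Qed.

Lemma omega_injl u v : (forall w, omega u w = omega v w) -> u = v.
Proof.
by move=> e; apply: omega_inj => w; rewrite omega_antisym e -omega_antisym.
Qed.

Lemma omegaDr w u v : omega w (u + v) = omega w u + omega w v.
Proof. exact: (linear_funD (omega_linear w)). Qed.

Lemma omegaNr w u : omega w (- u) = - omega w u.
Proof. exact: (linear_funN (omega_linear w)). Qed.

Lemma omegaZr w a u : omega w (a *: u) = a * omega w u.
Proof. exact: (linear_funZ (omega_linear w)). Qed.

Lemma omegaDl u v w : omega (u + v) w = omega u w + omega v w.
Proof. by rewrite omega_antisym omegaDr opprD -!omega_antisym. Qed.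

Lemma omegaNl u w : omega (- u) w = - omega u w.
Proof. by rewrite omega_antisym omegaNr -omega_antisym. Qed.

Lemma omegaZl a u w : omega (a *: u) w = a * omega u w.
Proof. by rewrite omega_antisym omegaZr -mulrN -omega_antisym. Qed.

Lemma omega0l w : omega 0 w = 0.
Proof. by rewrite -(scale0r 0) omegaZl mul0r. Qed.

Lemma flatE w u : flat w u = omega w u.
Proof. exact: linfun_linearE. Qed.

Lemma sharp_flat w : sharp (flat w) = w.
Proof. by apply: omega_injl => u; rewrite omega_r flatE. Qed.

(** Since r inverts omega, it carries the transpose of f to the omega-adjoint of f. *)
Lemma sharp_transpose (f g : h -> h) phi : linear f ->
  (forall u v, omega u (f v) = omega (g u) v) ->
  sharp (transpose f phi) = g (sharp phi).
Proof.
by move=> lf adj; apply: omega_injl => u; rewrite omega_r transposeE // -omega_r.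
Qed.

Lemma ad_tensE u (t : tensor h h) phi :
  (ad_tens br u t : 'Hom(_, _)) phi =
  (t : 'Hom(_, _)) (transpose (br u) phi) + br u ((t : 'Hom(_, _)) phi).
Proof.
have lid : linear (@id h) by [].
by rewrite add_lfunE !tens_mapE ?transpose_id //; exact: linear_brr.
Qed.

(* Under [phi |-> sharp phi] the cobracket is dual to the bracket of [h]. *)
Lemma delta_omega u (phi psi : 'Hom(h, K^o)) :
  psi ((delta u : 'Hom(_, _)) phi) = omega (br (sharp phi) (sharp psi)) u.
Proof.
(* Through [omega_r] the two summands become - omega (sharp phi, [u, sharp psi]) and omega (sharp
   psi, [u, sharp phi]), which the cocycle identity combines. *)
rewrite ad_tensE linearD /= -[X in X + _]omega_r -[X in _ + X]omega_r.
rewrite [X in X + _]omega_antisym omega_r (transposeE (linear_brr u)) -omega_r.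
have /eqP := omega_cocycle (sharp phi) (sharp psi) u.
rewrite -addrA addr_eq0 => /eqP ->; rewrite opprD.
rewrite [omega (br u _) _]omega_antisym opprK; congr (- _ + _).
by rewrite (br_antisym (sharp psi)) omegaNl -omega_antisym.
Qed.

Lemma omega_delta w u phi :
  omega w ((delta u : 'Hom(_, _)) phi) = omega (br (sharp phi) w) u.
Proof. by rewrite -flatE delta_omega sharp_flat. Qed.

Lemma linear_delta : linear delta.
Proof.
move=> a u v; apply: tensor_eq => phi psi.
rewrite delta_omega add_lfunE scale_lfunE linearD linearZ /= !delta_omega.
by rewrite omegaDr omegaZr.
Qed.

Lemma coboundary_lie_bialgebra : lie_bialgebra br delta.
Proof.
split=> //; first split.
- exact: linear_delta.
- move=> u; apply: tensor_eq => phi psi.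
  rewrite opp_lfunE linearN /= tens_flipE !delta_omega.
  by rewrite br_antisym omegaNl.
- move=> u t.
  (* Applying the duality twice, the iterated cobracket on three functionals is an iterated bracket
     paired with u. *)
  have tE (phi psi chi : 'Hom(h, K^o)) :
      chi (((t : 'Hom(_, tensor h h)) phi : 'Hom(_, _)) psi)
      = omega (br (sharp phi) (br (sharp psi) (sharp chi))) u.
    have lid : linear (@id h) by [].
    rewrite /t (tens_mapE _ _ lid linear_delta) transpose_id delta_omega.
    exact: omega_delta.
  apply/lfunP => phi; apply: tensor_eq => psi chi.
  rewrite !add_lfunE !linearD /= !tens_cycleE !tE zero_lfunE zero_lfunE linear0.
  have := lie_jacobi lie_br (sharp phi) (sharp psi) (sharp chi).
  move/(congr1 (omega^~ u)); rewrite !omegaDl omega0l => <-.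
  by rewrite -!addrA; congr (_ + _); rewrite addrC.
(* As delta is a coboundary, the cocycle condition follows from ad being a representation. *)
move=> x y; apply/lfunP => phi.
rewrite [RHS]add_lfunE opp_lfunE !ad_tensE !(linear_funD (linear_brr _)).
(* Transposition reverses composition, hence the opposite order of x and y. *)
have -> : transpose (br (br x y)) phi
    = transpose (br y) (transpose (br x) phi)
      - transpose (br x) (transpose (br y) phi).
  apply/lfunP => z; rewrite add_lfunE opp_lfunE.
  by rewrite !(transposeE (linear_brr _)) br_br linearB.
rewrite linearB /= br_br !opprD -!addrA; congr (_ + _).
(* The mixed terms, where one of x, y acts through the transpose and the other through the bracket,
   cancel in pairs. *)
set B := br y (sharp (transpose _ _)); set C := br x (sharp (transpose _ _)).
rewrite [X in B + (C + (_ + X))]addrCA [X in B + (C + X)]addrCA addNKr.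
by rewrite [X in B + (_ + X)]addrCA [X in B + X]addrCA addNKr addrCA.
Qed.

(** * Adjoint operators and Rota-Baxter Lie bialgebras *)

Section RotaBaxter.
Context (lambda : K) (R S : h -> h).
Hypotheses (linear_R : linear R) (linear_S : linear S).
Hypothesis adjoint_RS : forall u v, omega u (S v) = omega (R u) v.
Hypothesis rb_R : rota_baxter_op lambda br R.
Hypothesis bracket_RS : forall u v,
  S (br (R u) v) = br (R u) (S v) + S (br u (S v)) + lambda *: br u (S v).

Lemma adjoint_SR u v : omega u (R v) = omega (S u) v.
Proof. by rewrite omega_antisym -adjoint_RS -omega_antisym. Qed.

Lemma coboundary_rota_baxter_lie_bialgebra :
  rota_baxter_lie_bialgebra lambda br R delta S.
Proof.
have lid : linear (@id h) by [].
have sS := fun phi => sharp_transpose phi linear_S adjoint_RS.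
have sR := fun phi => sharp_transpose phi linear_R adjoint_SR.
split=> //; first exact: coboundary_lie_bialgebra.
- move=> x; apply/lfunP => phi; apply: omega_inj => w.
  rewrite !add_lfunE !scale_lfunE !tens_mapE // !transpose_id.
  (* Adjointness turns every [S] into an [R] on the bracket or its arguments, leaving the identity
     of [R] at sharp phi and w. *)
  rewrite !omegaDr !omegaZr !adjoint_RS !omega_delta !sS !adjoint_RS.
  by rewrite rb_R !omegaDl omegaZl.
- by move=> x y; rewrite -!addrA -!opprD !addrA bracket_RS subrr.
move=> x; apply/lfunP => phi; apply: omega_inj => w.
rewrite !(add_lfunE, opp_lfunE, scale_lfunE, zero_lfunE) !tens_mapE // !transpose_id.
rewrite !omegaDr omegaNr !omegaZr !adjoint_RS !omega_delta !sR !adjoint_SR.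
(* With [R] and [S] exchanged by adjointness, the goal is [bracket_RS] at w and sharp phi, up to
   antisymmetry. *)
have := congr1 (omega^~ x) (bracket_RS w (sharp phi)).
rewrite (br_antisym (S _) (R w)) (br_antisym (S _) w) (br_antisym _ (R w)).
rewrite !(linear_funN linear_S) !omegaDl !omegaNl omegaZl => ->.
rewrite (linear_fun0 (omega_linear w)); ring.
Qed.

End RotaBaxter.

End SymplecticLieAlgebra.

(** * The semidirect product of a pre-Lie algebra with its dual *)

Section SemidirectDouble.
Context (K : fieldType) (A : vectType K) (circ : A -> A -> A).
Hypothesis pre_lie_circ : pre_lie_algebra circ.

Local Notation h := (A * 'Hom(A, K^o))%type.
Local Notation br := (dual_semidirect circ).

Definition double_form (u v : h) : K := (u.2 v.1 : K) - v.2 u.1.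

Lemma circ_linearl y : linear (circ^~ y).
Proof. by case: pre_lie_circ => [[]]. Qed.

Lemma circ_linearr x : linear (circ x).
Proof. by case: pre_lie_circ => [[]]. Qed.

(** Left-symmetry as a rewriting rule: applied to one of each pair (x y) z, (y x) z, it leaves terms
    that [ring] cancels. *)
Lemma circ_circ x y z :
  circ (circ x y) z = circ (circ y x) z - circ y (circ x z) + circ x (circ y z).
Proof. by rewrite -(pre_lie_left_sym pre_lie_circ) subrK. Qed.

Lemma L_starE x phi y : L_star circ x phi y = - (phi (circ x y) : K).
Proof.
rewrite /L_star linfun_linearE // => a u v.
by rewrite circ_linearr -[RHS]/(a * _ + _ : K) !dualE; ring.
Qed.

Lemma linear_L_star x : linear (L_star circ x).
Proof.
move=> a phi psi; apply: dual_eq => y.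
by rewrite !(L_starE, dualE); ring.
Qed.

Lemma L_star_linear phi : linear ((L_star circ)^~ phi).
Proof.
move=> a x y; apply: dual_eq => z.
by rewrite !(L_starE, dualE) circ_linearl !dualE; ring.
Qed.

Lemma double_form_linear w : linear (double_form w : h -> K^o).
Proof.
move=> a u v; rewrite /double_form -[RHS]/(a * _ + _ : K) /= !dualE; ring.
Qed.

Lemma double_form_antisym u v : double_form u v = - double_form v u.
Proof. by rewrite /double_form opprB. Qed.

(** With e_i' the dual basis, r phi is the sum of phi(e_i) e_i' - phi(e_i') e_i, so pairing it with
    u expands phi(u) over the basis e_i, e_i' of h. *)
Lemma double_form_canonical_r n (e : n.-tuple A) (phi : 'Hom(h, K^o)) u :
  basis_of {:A} e ->
  double_form ((canonical_r e : 'Hom('Hom(h, K^o), h)) phi) u = phi u.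
Proof.
move=> he.
have lin : linear (double_form^~ u : h -> K^o).
  move=> a v w; rewrite [LHS]double_form_antisym double_form_linear.
  rewrite -[LHS]/(- (a * _ + _ : K)) -[RHS]/(a * _ + _ : K).
  by rewrite ![double_form u _]double_form_antisym; ring.
have {2}-> : u = \sum_(i < n) ((coord e i u.1 *: e`_i, 0)
                  + (0, u.2 e`_i *: dual_basis e i) : h).
  case: (u) => y b; rewrite big_split [RHS]surjective_pairing !raddfD /=.
  rewrite !(raddf_sum fst) !(raddf_sum snd) /= !big1_eq addr0 add0r.
  rewrite -(coord_basis he (memvf y)); congr pair; apply: dual_eq => z.
  rewrite {1}(coord_basis he (memvf z)) linear_sum sum_lfunE.
  by apply: eq_bigr => i _; rewrite linearZ scale_lfunE dual_basisE [RHS]mulrC.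
rewrite /canonical_r sum_lfunE (linear_fun_sum lin) linear_sum.
apply: eq_bigr => i _; rewrite add_lfunE opp_lfunE !tensE.
have -> : (coord e i u.1 *: e`_i, 0) = coord e i u.1 *: ((e`_i, 0) : h).
  by congr pair; rewrite /= scaler0.
have -> : (0, u.2 e`_i *: dual_basis e i)
    = (u.2 e`_i : K) *: ((0, dual_basis e i) : h).
  by congr pair; rewrite /= scaler0.
rewrite -[RHS]/(phi _ : K) !dualE.
by rewrite /double_form /= !dualE dual_basisE; ring.
Qed.

(** Each of the scalars a(y z), a(z y), b(z x), b(x z), c(x y), c(y x) occurs twice, with opposite
    signs. *)
Lemma double_form_cocycle u v w :
  double_form (br u v) w + double_form (br v w) u + double_form (br w u) v = 0.
Proof.
case: u v w => [x a] [y b] [z c]; rewrite /double_form /= /commutator.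
rewrite !(L_starE, dualE); ring.
Qed.

Lemma double_lie_algebra : lie_algebra br.
Proof.
split.
- split=> [v|u] a x y; congr pair; rewrite /= /commutator;
    rewrite ?circ_linearl ?circ_linearr ?L_star_linear ?linear_L_star;
    by rewrite scalerBr opprD addrACA.
- by case=> x a; rewrite /dual_semidirect /semidirect /commutator /= !subrr.
case=> [x a] [y b] [z c]; congr pair => /=.
  apply: dual_separates => phi; rewrite /commutator.
  rewrite !(linear_funB (circ_linearl _)) !(linear_funB (circ_linearr _)).
  rewrite (circ_circ x y z) (circ_circ y z x) (circ_circ z x y).
  by rewrite !dualE; ring.
(* The dual component says that [L_star] is a representation of g(A), which is left-symmetry. *)
apply: dual_eq => t; rewrite !(L_starE, dualE) /commutator.
rewrite !(linear_funB (circ_linearl _)).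
rewrite (circ_circ x y t) (circ_circ y z t) (circ_circ z x t).
by rewrite !dualE; ring.
Qed.

Lemma linear_transpose (f : A -> A) : linear f -> linear (transpose f).
Proof.
by move=> lf a phi psi; apply: dual_eq => x; rewrite !(transposeE lf, dualE).
Qed.

(* [R] is [P] on [A] and the transpose of [Q] on the dual, so that [S], which
   exchanges the roles of [P] and [Q], is its adjoint for [double_form]. *)
Lemma double_rota_baxter (lambda : K) (P Q : A -> A) (R S : h -> h)
    n (e : n.-tuple A) :
  basis_of {:A} e -> linear P -> linear Q -> rota_baxter_op lambda circ P ->
  (forall x y, Q (circ (P x) y)
     = circ (P x) (Q y) + Q (circ x (Q y)) + lambda *: circ x (Q y)) ->
  (forall x y, Q (circ y (P x))
     = circ (Q y) (P x) + Q (circ (Q y) x) + lambda *: circ (Q y) x) ->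
  (forall u, R u = (P u.1, transpose Q u.2)) ->
  (forall u, S u = (Q u.1, transpose P u.2)) ->
  rota_baxter_lie_bialgebra lambda br R
    (fun u => ad_tens br u (canonical_r e)) S.
Proof.
move=> he lP lQ rbP QP PQ RE SE.
have lPt := linear_transpose lP; have lQt := linear_transpose lQ.
apply: (coboundary_rota_baxter_lie_bialgebra double_lie_algebra
          double_form_linear double_form_antisym) => //.
- by move=> phi u; exact: double_form_canonical_r.
- exact: double_form_cocycle.
- by move=> a u v; rewrite !RE /= lP lQt.
- by move=> a u v; rewrite !SE /= lQ lPt.
- by move=> u v; rewrite RE SE /double_form /= !transposeE.
- move=> [x a] [y b]; rewrite !RE /=; congr pair => /=; rewrite /commutator.
    apply: dual_separates => phi.
    by rewrite !(rbP, linear_funB lP, scalerBr, dualE); ring.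
  (* At z, the dual component is [QP] at x, z under b and at y, z under a. *)
  apply: dual_eq => z.
  rewrite !(linear_funB lQt, dualE, L_starE, transposeE lQ, QP).
  ring.
move=> [x a] [y b]; rewrite !RE !SE /=; congr pair => /=; rewrite /commutator.
  (* The component in A is the difference of [QP] and [PQ]. *)
  apply: dual_separates => phi.
  by rewrite !(linear_funB lQ, QP, PQ, dualE); ring.
(* At z, the terms in b form the Rota-Baxter identity of P, those in a form [PQ]. *)
apply: dual_eq => z.
rewrite !(linear_funB lPt, dualE, L_starE, transposeE lP, transposeE lQ, rbP, PQ).
ring.
Qed.

End SemidirectDouble.

(** * The three choices of Q *)

Theorem proposition4p24 (K : fieldType) (charK : [pchar K] =i pred0)
    (lambda : K) (A : vectType K) (circ : A -> A -> A) (P : A -> A)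
    (hA : rota_baxter_pre_lie_algebra lambda circ P)
    (n : nat) (e : n.-tuple A) (he : basis_of {:A} e) :
  let br := dual_semidirect circ in
  let delta := fun u => ad_tens br u (canonical_r e) in
  [/\ rota_baxter_lie_bialgebra lambda br
        (fun u => (P u.1, 0)) delta (fun u => (0, transpose P u.2)),
      rota_baxter_lie_bialgebra lambda br
        (fun u => (P u.1, - (lambda *: u.2))) delta
        (fun u => (- (lambda *: u.1), transpose P u.2))
    & rota_baxter_lie_bialgebra lambda br
        (fun u => (P u.1, - (lambda *: u.2) - transpose P u.2)) delta
        (fun u => (- P u.1 - lambda *: u.1, transpose P u.2))].
Proof.
case: hA => plA lP rbP br delta.
have cl y := circ_linearl plA y; have cr x := circ_linearr plA x.
split.
- have lQ : linear (fun _ : A => 0 : A) by move=> a x y; rewrite scaler0 addr0.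
  apply: (double_rota_baxter plA (Q := fun=> 0) he lP lQ rbP) => // [x y|x y|u].
  + by rewrite (linear_fun0 (cr _)) (linear_fun0 (cr _)) scaler0 !addr0.
  + by rewrite (linear_fun0 (cl _)) (linear_fun0 (cl _)) scaler0 !addr0.
  by congr pair; apply: dual_eq => z; rewrite transposeE // !dualE.
- have lQ : linear (fun x : A => - (lambda *: x)).
    by move=> a x y; rewrite scalerDr opprD scalerN !scalerA mulrC.
  (* For Q = - lambda id the last two terms of each condition cancel. *)
  apply: (double_rota_baxter plA he lP lQ rbP) => // [x y|x y|u].
  + by rewrite !(linear_funN (cr _), linear_funZ (cr _)) scalerN opprK addrK.
  + by rewrite !(linear_funN (cl _), linear_funZ (cl _)) scalerN opprK addrK.
  by congr pair; apply: dual_eq => z; rewrite transposeE // !dualE.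
have lQ : linear (fun x : A => - P x - lambda *: x).
  move=> a x y; rewrite lP; apply: dual_separates => phi; rewrite !dualE; ring.
(* Since Q + lambda id = - P, both conditions become the Rota-Baxter identity of P. *)
apply: (double_rota_baxter plA he lP lQ rbP) => // [x y|x y|u].
- apply: dual_separates => phi.
  rewrite !(linear_funB (cr _), linear_funN (cr _), linear_funZ (cr _)).
  rewrite !(linear_funB lP, linear_funN lP, linear_funZ lP) rbP !dualE; ring.
- apply: dual_separates => phi.
  rewrite !(linear_funB (cl _), linear_funN (cl _), linear_funZ (cl _)).
  rewrite !(linear_funB lP, linear_funN lP, linear_funZ lP) rbP !dualE; ring.
by congr pair; apply: dual_eq => z; rewrite !dualE !transposeE // !dualE; ring.
Qed.
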